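(* Let $\beta_g: I\to M\subset G^3$ be a unit-speed curve on a surface $M$ in the Galilean space $G^3$ which is a geodesic ($\kappa_g\equiv0$), with normal curvature $\kappa_n$ and geodesic torsion $\tau_g$. Then its position vector is given by $$\beta_g(x)=\Bigg(x,\ -\int\!\!\int\kappa_n(x)\Big(\int\tau_g(x)S_{\tau_g}\,dx\Big)dx\,dx,\ -\int\!\!\int\kappa_n(x)\Big(\int\tau_g(x)C_{\tau_g}\,dx\Big)dx\,dx\Bigg),$$ where $C_{\tau_g}=\cos\big[\int\tau_g(x)\,dx\big]$ and $S_{\tau_g}=\sin\big[\int\tau_g(x)\,dx\big]$.
   Context: The Galilean space $G^3$ is $\mathbb R^3$ with the scalar product $\mathbf v\cdot_G\mathbf w=v_1w_1$ if $v_1\ne0$ or $w_1\neq 0$, and $\mathbf v\cdot_G\mathbf w=v_2w_2+v_3w_3$ if $v_1=w_1=0$; the norm is $\|\mathbf v\|_G=\sqrt{|\mathbf v\cdot_G\mathbf v|}$ and the cross product is $\mathbf v\times_G\mathbf w=(0,\,v_3w_1-v_1w_3,\,v_1w_2-v_2w_1)$. A unit-speed curve (parametrized by arc length) is one of the form $\beta(x)=(x,y(x),z(x))$, $x\in I\subset\mathbb R$. $M$ is oriented; the Darboux frame of a unit-speed curve $\beta$ with respect to $M$ is $\{\mathbf T,\mathbf Q,\mathbf n\}$ with $\mathbf T=\beta'$, $\mathbf n$ the unit normal of $M$ along $\beta$ (a vector field with first component $0$), and $\mathbf Q=\mathbf n\times_G\mathbf T$. The geodesic curvature $\kappa_g$,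 normal curvature $\kappa_n$ and geodesic torsion $\tau_g$ are the functions in $\mathbf T'=\kappa_g\mathbf Q+\kappa_n\mathbf n$, $\mathbf Q'=\tau_g\mathbf n$, $\mathbf n'=-\tau_g\mathbf Q$. The symbol $\int g(x)\,dx$ denotes an antiderivative of $g$, the constants of integration being suitably chosen. *)

(* Defs.v *)
From Stdlib Require Export Reals.
From Coquelicot Require Export Coquelicot.
Open Scope R_scope.

Definition G3 : NormedModule R_AbsRing :=
  prod_NormedModule R_AbsRing
    (prod_NormedModule R_AbsRing R_NormedModule R_NormedModule) R_NormedModule.

Definition vec (a b c : R) : G3 := ((a, b), c).
Definition c1 (v : G3) : R := fst (fst v).
Definition c2 (v : G3) : R := snd (fst v).
Definition c3 (v : G3) : R := snd v.

Definition gal_dot (v w : G3) : R :=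
  if Req_EM_T (c1 v) 0 then
    if Req_EM_T (c1 w) 0 then c2 v * c2 w + c3 v * c3 w else c1 v * c1 w
  else c1 v * c1 w.

Definition gal_norm (v : G3) : R := sqrt (Rabs (gal_dot v v)).

Definition gal_cross (v w : G3) : G3 :=
  vec 0 (c3 v * c1 w - c1 v * c3 w) (c1 v * c2 w - c2 v * c1 w).

(** [X], defined on the open set [U] of the plane, is a regular local
    parametrization of the set [S], positively oriented for the normal
    field [N]: a C^1 homeomorphism of [U] onto a relatively open part of [S]
    whose normalized cross product of partial derivatives is [N].
    Nonvanishing of the Galilean cross product is the regularity condition
    needed for the unit normal to exist: it says that the partial derivatives
    are independent and that the tangent plane is not the plane [c1 = 0].
    C^1 is the least regularity making sense of the unit normal; the
    differentiability of the normal along a curve is part of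
    [darboux_equations]. *)
Record local_parametrization (S : G3 -> Prop) (N : G3 -> G3)
    (U : R * R -> Prop) (X : R * R -> G3) : Prop := {
  lp_open : open U;
  lp_in : forall p, U p -> S (X p);
  lp_inj : forall p q, U p -> U q -> X p = X q -> p = q;
  lp_embedding : forall W : R * R -> Prop, open W -> (forall p, W p -> U p) ->
    exists O : G3 -> Prop, open O /\
      forall q : G3, (exists p, W p /\ X p = q) <-> (S q /\ O q);
  lp_regular : exists Xu Xv : R * R -> G3, forall p, U p ->
    is_derive (fun u => X (u, snd p)) (fst p) (Xu p) /\
    is_derive (fun v => X (fst p, v)) (snd p) (Xv p) /\
    continuous Xu p /\ continuous Xv p /\
    gal_cross (Xu p) (Xv p) <> vec 0 0 0 /\
    N (X p) = scal (/ gal_norm (gal_cross (Xu p) (Xv p)))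
                   (gal_cross (Xu p) (Xv p))
}.

(** The values of [unit_normal] off the carrier are irrelevant. *)
Record oriented_surface := {
  carrier :> G3 -> Prop;
  unit_normal : G3 -> G3;
  atlas : forall q, carrier q ->
    exists (U : R * R -> Prop) (X : R * R -> G3),
      local_parametrization carrier unit_normal U X /\
      exists p, U p /\ X p = q
}.

(** Curves are functions on [R] of which only the restriction to [I] matters. *)
Definition is_open_interval (I : R -> Prop) : Prop :=
  open I /\ forall a b x, I a -> I b -> a <= x <= b -> I x.

Definition unit_speed (I : R -> Prop) (beta : R -> G3) : Prop :=
  forall x, I x -> c1 (beta x) = x.

Record darboux_frame (M : oriented_surface) (I : R -> Prop) (beta : R -> G3)
    (T Q n : R -> G3) : Prop := {
  df_T : forall x, I x -> is_derive beta x (T x);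
  df_n : forall x, I x -> n x = unit_normal M (beta x);
  df_Q : forall x, I x -> Q x = gal_cross (n x) (T x)
}.

Record darboux_equations (I : R -> Prop) (T Q n : R -> G3)
    (kappa_g kappa_n tau_g : R -> R) : Prop := {
  de_T : forall x, I x ->
    is_derive T x (plus (scal (kappa_g x) (Q x)) (scal (kappa_n x) (n x)));
  de_Q : forall x, I x -> is_derive Q x (scal (tau_g x) (n x));
  de_n : forall x, I x -> is_derive n x (scal (- tau_g x) (Q x))
}.

Definition geodesic (I : R -> Prop) (kappa_g : R -> R) : Prop :=
  forall x, I x -> kappa_g x = 0.

(** [G] is a value of the indefinite integral of [g] on [I].  Each occurrence
    of an integral sign carries its own constant of integration.  In
    particular the integrals of [tau_g] inside the sine and inside the cosine
    are chosen separately: with [Q = gal_cross n T] one has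
    [n = (0, cos t, sin t)] and [Q = (0, sin t, - cos t)] with [t' = tau_g],
    so that the sine takes the angle [t] and the cosine the angle [t + PI]. *)
Definition is_antiderivative (I : R -> Prop) (g G : R -> R) : Prop :=
  forall x, I x -> is_derive G x (g x).

(* Main.v *)
(** Along a unit-speed curve [T = (1, y', z')] and [n] is a Euclidean unit
    vector of the plane [c1 = 0], so [Q = (0, n3, - n2)] and the Darboux
    equations read [n2' = - tau_g n3], [n3' = tau_g n2], [y'' = kappa_n n2],
    [z'' = kappa_n n3].  Writing [n = (0, cos t, sin t)] with [t' = tau_g], the
    antiderivatives sought are [- n2] and [- n3], then [- y'], [- y] and
    [- z'], [- z].

    The only difficulty is the existence of [t]: [tau_g] need not be continuous,
    nor even Riemann integrable.  Near each point [x0] the arctangent of the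
    slope of [n] relative to [n x0] is an antiderivative of [tau_g], and local
    antiderivatives on an interval glue to a global one. *)
From Stdlib Require Import Reals Lra Classical IndefiniteDescription.
From Coquelicot Require Import Coquelicot.
Require Import Defs.
Open Scope R_scope.

(** * Coordinatewise differentiation in [G3] *)

(** Chain rule with a bounded linear map. Applied to [c1], [c2], [c3], it turns vector derivatives
    into scalar ones. *)
Lemma is_derive_linear {V W : NormedModule R_AbsRing} (L : V -> W)
    (f : R -> V) (x : R) (l : V) :
  is_linear L -> is_derive f x l -> is_derive (fun t => L (f t)) x (L l).
Proof.
  intros HL Hf.
  apply filterdiff_ext_lin with (fun y => L (scal y l)).
  - apply (filterdiff_comp' f L x (fun y => scal y l) L).
    + exact Hf.
    + now apply filterdiff_linear.
  - intros y. apply (linear_scal L HL).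
Qed.

Lemma is_linear_c1 : is_linear (c1 : G3 -> R_NormedModule).
Proof.
  apply (is_linear_comp (U := G3)
    (V := prod_NormedModule R_AbsRing R_NormedModule R_NormedModule)
    (W := R_NormedModule) fst fst); apply is_linear_fst.
Qed.

Lemma is_linear_c2 : is_linear (c2 : G3 -> R_NormedModule).
Proof.
  apply (is_linear_comp (U := G3)
    (V := prod_NormedModule R_AbsRing R_NormedModule R_NormedModule)
    (W := R_NormedModule) fst snd); [apply is_linear_fst | apply is_linear_snd].
Qed.

Lemma is_linear_c3 : is_linear (c3 : G3 -> R_NormedModule).
Proof. apply is_linear_snd. Qed.

Lemma vec_eta (v : G3) : v = vec (c1 v) (c2 v) (c3 v).
Proof. now destruct v as [[a b] c]. Qed.

(** * Gluing of local antiderivatives *)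

(** Because the values at [b] agree, each difference quotient at [b] is one of [F] or one of [G],
    according to the sign of the increment. *)
Lemma is_derive_glue (F G : R -> R) (b l : R) :
  F b = G b -> is_derive F b l -> is_derive G b l ->
  is_derive (fun y => if Rle_dec y b then F y else G y) b l.
Proof.
  intros Hb HF HG.
  apply is_derive_Reals in HF. apply is_derive_Reals in HG.
  apply is_derive_Reals. intros eps Heps.
  destruct (HF eps Heps) as [d1 H1]. destruct (HG eps Heps) as [d2 H2].
  assert (Hd : 0 < Rmin d1 d2)
    by (apply Rmin_glb_lt; [apply (cond_pos d1) | apply (cond_pos d2)]).
  exists (mkposreal _ Hd). simpl. intros h Hh Hlt.
  destruct (Rle_dec b b) as [_ | Hn]; [| lra].
  destruct (Rle_dec (b + h) b).
  - apply H1; trivial. apply (Rlt_le_trans _ _ _ Hlt), Rmin_l.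
  - rewrite Hb. apply H2; trivial. apply (Rlt_le_trans _ _ _ Hlt), Rmin_r.
Qed.

Lemma antiderivative_add_const (I : R -> Prop) (g G : R -> R) (c : R) :
  is_antiderivative I g G -> is_antiderivative I g (fun x => G x + c).
Proof.
  intros HG x Ix. replace (g x) with (plus (g x) zero) by apply plus_zero_r.
  apply (is_derive_plus (V := R_NormedModule) G (fun _ => c)); [now apply HG |].
  apply (is_derive_const (V := R_NormedModule)).
Qed.

Lemma antiderivative_concat (g F G : R -> R) (a b c : R) :
  is_antiderivative (fun y => a <= y <= b) g F ->
  is_antiderivative (fun y => b <= y <= c) g G ->
  exists H, is_antiderivative (fun y => a <= y <= c) g H.
Proof.
  intros HF HG.
  (* The constant makes the two pieces agree at [b]. *)
  exists (fun y => if Rle_dec y b then F y else G y + (F b - G b)).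
  intros y Hy.
  assert (HG' : b <= y -> is_derive (fun t => G t + (F b - G b)) y (g y)).
  { intros Hby. apply (antiderivative_add_const _ _ _ _ HG). lra. }
  destruct (Rtotal_order y b) as [Hlt | [Heq | Hgt]].
  - apply is_derive_ext_loc with F; [| apply HF; lra].
    apply (filter_imp (fun t => t < b)).
    + intros t Ht. destruct (Rle_dec t b); [reflexivity | lra].
    + now apply open_lt.
  - subst y. apply is_derive_glue; [ring | apply HF; lra | apply HG'; lra].
  - apply is_derive_ext_loc with (fun t => G t + (F b - G b)); [| apply HG'; lra].
    apply (filter_imp (fun t => b < t)).
    + intros t Ht. destruct (Rle_dec t b); [lra | reflexivity].
    + now apply open_gt.
Qed.

(** Supremum argument: the right ends reachable from [a] have a least upper bound [s], and a local
    antiderivative around [s] leads past it unless [b] is reached. *)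
Lemma antiderivative_segment (g : R -> R) (a b : R) :
  a <= b ->
  (forall x, a <= x <= b -> exists (eps : posreal) (G : R -> R),
     is_antiderivative (fun y => Rabs (y - x) < eps) g G) ->
  exists G, is_antiderivative (fun y => a <= y <= b) g G.
Proof.
  intros Hab Hloc.
  pose (E := fun x => a <= x <= b /\
               exists G, is_antiderivative (fun y => a <= y <= x) g G).
  assert (Ea : E a).
  { split; [lra |].
    destruct (Hloc a) as [eps [G HG]]; [lra |].
    exists G. intros y Hy. apply HG.
    replace (y - a) with 0 by lra. rewrite Rabs_R0. apply cond_pos. }
  destruct (completeness E) as [s [Hub Hlub]].
  { exists b. intros x [Hx _]; lra. }
  { now exists a. }
  assert (Hs : a <= s <= b).
  { split; [now apply Hub |]. apply Hlub. intros x [Hx _]; lra. }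
  destruct (Hloc s Hs) as [eps [H HH]].
  pose proof (cond_pos eps) as Heps.
  assert (Hx : exists x, E x /\ s - eps < x).
  { apply NNPP. intros Hn. assert (s <= s - eps); [| lra].
    apply Hlub. intros x Ex. apply Rnot_lt_le. intros Hlt. apply Hn. eauto. }
  destruct Hx as [x [Ex Hsx]].
  assert (Hxs : x <= s) by now apply Hub.
  destruct Ex as [Hax [F HF]].
  assert (Ereach : forall c, c <= b -> c < s + eps ->
            exists G, is_antiderivative (fun y => a <= y <= c) g G).
  { intros c Hcb Hc. apply (antiderivative_concat g F H a x c HF).
    intros y Hy. apply HH. apply Rabs_def1; lra. }
  destruct (Rlt_le_dec b (s + eps)) as [Hb | Hb].
  - apply Ereach; lra.
  (* Here [s + eps / 2] is still below [b], hence reachable, against the choice of [s]. *)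
  - assert (s + eps / 2 <= s); [| lra].
    apply Hub. split; [lra |]. apply Ereach; lra.
Qed.

Lemma antiderivative_eq (g F G : R -> R) (a b x y : R) :
  is_antiderivative (fun t => a <= t <= b) g F ->
  is_antiderivative (fun t => a <= t <= b) g G ->
  a <= x <= b -> a <= y <= b -> F x = G x -> F y = G y.
Proof.
  intros HF HG Hx Hy Heq.
  assert (HD : forall t, a <= t <= b -> is_derive (fun t => F t - G t) t 0).
  { intros t Ht. rewrite <- (Rminus_diag (g t)).
    apply (is_derive_minus (V := R_NormedModule) F G); auto. }
  destruct (Rtotal_order x y) as [Hlt | [-> | Hlt]]; [| exact Heq |].
  - enough (F x - G x = F y - G y) by lra.
    apply (eq_is_derive (V := R_NormedModule) (fun t => F t - G t));
      [intros t Ht; apply HD; lra | exact Hlt].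
  - enough (F y - G y = F x - G x) by lra.
    apply (eq_is_derive (V := R_NormedModule) (fun t => F t - G t));
      [intros t Ht; apply HD; lra | exact Hlt].
Qed.

(** Prescribing the value [v] at [a] makes antiderivatives on different segments around [a] agree
    where both are defined, so their values define one function on [I]. *)
Lemma antiderivative_of_local (I : R -> Prop) (g : R -> R) (a v : R) :
  is_open_interval I -> I a ->
  (forall x, I x -> exists (eps : posreal) (G : R -> R),
     is_antiderivative (fun y => Rabs (y - x) < eps) g G) ->
  exists G, G a = v /\ is_antiderivative I g G.
Proof.
  intros [Hopen Hconv] Ia Hloc.
  assert (Hseg : forall b c, I b -> I c -> b <= a <= c -> exists G,
            G a = v /\ is_antiderivative (fun y => b <= y <= c) g G).
  { intros b c Ib Ic Hbc.
    destruct (antiderivative_segment g b c) as [G HG]; [lra | |].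
    { intros x Hx. apply Hloc. now apply (Hconv b c). }
    exists (fun y => G y + (v - G a)). split; [ring |].
    now apply antiderivative_add_const. }
  (* The quantifier on [w] stands before [I x] so that choice yields a total function; off [I] the
     value is arbitrary. *)
  assert (Hval : forall x, exists w, I x -> exists G, G a = v /\ G x = w /\
            is_antiderivative (fun y => Rmin a x <= y <= Rmax a x) g G).
  { intros x. destruct (classic (I x)) as [Ix | Nx]; [| now exists 0].
    destruct (Hseg (Rmin a x) (Rmax a x)) as [G [Ga HG]].
    - unfold Rmin; now destruct Rle_dec.
    - unfold Rmax; now destruct Rle_dec.
    - split; [apply Rmin_l | apply Rmax_l].
    - exists (G x). intros _. now exists G. }
  apply functional_choice in Hval. destruct Hval as [F HF].
  assert (Fseg : forall b c G, I b -> I c -> b <= a <= c -> G a = v ->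
            is_antiderivative (fun y => b <= y <= c) g G ->
            forall y, b <= y <= c -> F y = G y).
  { intros b c G Ib Ic Hbc Ga HG y Hy.
    destruct (HF y) as [H [Ha [<- HH]]]; [now apply (Hconv b c) |].
    apply (antiderivative_eq g H G (Rmin a y) (Rmax a y) a y).
    - exact HH.
    - intros t Ht. apply HG. revert Ht.
      unfold Rmin, Rmax; destruct Rle_dec; lra.
    - split; [apply Rmin_l | apply Rmax_l].
    - split; [apply Rmin_r | apply Rmax_r].
    - congruence. }
  exists F. split.
  - destruct (HF a Ia) as [G [Ga [<- _]]]. exact Ga.
  - intros x Ix.
    destruct (Hopen x Ix) as [eps Heps].
    pose proof (cond_pos eps) as Hpos.
    assert (Hnear : forall y, Rabs (y - x) < eps -> I y)
      by (intros y Hy; now apply Heps).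
    assert (I1 : I (x - eps / 2)) by (apply Hnear, Rabs_def1; lra).
    assert (I2 : I (x + eps / 2)) by (apply Hnear, Rabs_def1; lra).
    (* The segment between these ends contains both [a] and a neighbourhood of [x], on which [F]
       therefore equals a single antiderivative [G]. *)
    assert (Ib : I (Rmin a (x - eps / 2))) by (unfold Rmin; now destruct Rle_dec).
    assert (Ic : I (Rmax a (x + eps / 2))) by (unfold Rmax; now destruct Rle_dec).
    pose proof (Rmin_l a (x - eps / 2)). pose proof (Rmin_r a (x - eps / 2)).
    pose proof (Rmax_l a (x + eps / 2)). pose proof (Rmax_r a (x + eps / 2)).
    destruct (Hseg _ _ Ib Ic) as [G [Ga HG]]; [lra |].
    apply is_derive_ext_loc with G; [| apply HG; lra].
    assert (Hpos2 : 0 < eps / 2) by lra.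
    exists (mkposreal _ Hpos2). intros y Hy.
    change (Rabs (y - x) < eps / 2) in Hy. apply Rabs_def2 in Hy.
    symmetry. apply (Fseg _ _ G Ib Ic); trivial; lra.
Qed.

(** * The angle of a rotating unit vector *)

Lemma unit_vector_angle (p q : R) :
  p * p + q * q = 1 -> exists t, p = cos t /\ q = sin t.
Proof.
  intros H.
  assert (Hp : -1 <= p <= 1) by nra.
  assert (Hq : sqrt (1 - Rsqr p) = Rabs q).
  { rewrite <- sqrt_Rsqr_abs. f_equal. unfold Rsqr. lra. }
  destruct (Rle_lt_dec 0 q) as [Hq0 | Hq0].
  - exists (acos p).
    rewrite cos_acos, sin_acos, Hq, Rabs_pos_eq by trivial. auto.
  - exists (- acos p).
    rewrite cos_neg, sin_neg, cos_acos, sin_acos, Hq, Rabs_left by trivial.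
    split; [reflexivity | ring].
Qed.

Section Rotation.

Variables (I : R -> Prop) (p q tau : R -> R).
Hypothesis HI : is_open_interval I.
Hypothesis Hunit : forall x, I x -> p x * p x + q x * q x = 1.
Hypothesis Hp : forall x, I x -> is_derive p x (- tau x * q x).
Hypothesis Hq : forall x, I x -> is_derive q x (tau x * p x).

Lemma rotation_local_angle (x0 : R) :
  I x0 -> exists (eps : posreal) (G : R -> R),
    is_antiderivative (fun y => Rabs (y - x0) < eps) tau G.
Proof.
  intros I0.
  (* [u] and [w] are the coordinates of [(p, q)] in the orthonormal frame whose
     first vector is [(p x0, q x0)]. *)
  pose (u := fun x => p x0 * p x + q x0 * q x).
  pose (w := fun x => p x0 * q x - q x0 * p x).
  assert (Hu : forall x, I x -> is_derive u x (- tau x * w x)).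
  { intros x Ix. unfold u, w.
    replace (- tau x * (p x0 * q x - q x0 * p x))
      with (plus (p x0 * (- tau x * q x)) (q x0 * (tau x * p x)))
      by (unfold plus; simpl; ring).
    apply (is_derive_plus (V := R_NormedModule) (fun x => p x0 * p x) (fun x => q x0 * q x));
      apply is_derive_scal; auto. }
  assert (Hw : forall x, I x -> is_derive w x (tau x * u x)).
  { intros x Ix. unfold u, w.
    replace (tau x * (p x0 * p x + q x0 * q x))
      with (minus (p x0 * (tau x * p x)) (q x0 * (- tau x * q x)))
      by (unfold minus, plus, opp; simpl; ring).
    apply (is_derive_minus (V := R_NormedModule) (fun x => p x0 * q x) (fun x => q x0 * p x));
      apply is_derive_scal; auto. }
  assert (Hnear : locally x0 (fun x => I x /\ 0 < u x)).
  { apply filter_and; [now apply HI |].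
    assert (Hc : continuous u x0).
    { apply (ex_derive_continuous (V := R_NormedModule)). eexists. now apply Hu. }
    (* Positivity persists near [x0] because [u x0 = 1]. *)
    apply Hc, open_gt. unfold u. rewrite Hunit by trivial. lra. }
  destruct Hnear as [eps Heps].
  exists eps, (fun x => atan (w x / u x)).
  intros x Hx. destruct (Heps x Hx) as [Ix Hux].
  pose proof (Hu x Ix) as Dux. pose proof (Hw x Ix) as Dwx.
  auto_derive.
  - repeat split; [eexists; exact Dwx | eexists; exact Dux | lra].
  (* The derivative of the arctangent is [(w' u - w u') / (u^2 + w^2)], whose numerator is
     [tau (u^2 + w^2)]. *)
  - rewrite (is_derive_unique (fun y : R => u y) _ _ Dux),
      (is_derive_unique (fun y : R => w y) _ _ Dwx).
    unfold Rsqr. field. nra.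
Qed.

(** With [t] adjusted at one point [a], the vectors [(p, q)] and [(cos t, sin t)] turn at the same
    rate [tau], so their scalar product [D] keeps its initial value 1. *)
Lemma rotation_angle :
  exists t, is_antiderivative I tau t /\
    forall x, I x -> p x = cos (t x) /\ q x = sin (t x).
Proof.
  destruct (classic (exists a, I a)) as [[a Ia] | Hempty].
  2: { exists (fun _ => 0). split; intros x Ix; exfalso; eauto. }
  destruct (unit_vector_angle (p a) (q a) (Hunit a Ia)) as [v [Hpa Hqa]].
  destruct (antiderivative_of_local I tau a v HI Ia rotation_local_angle)
    as [t [Hta Ht]].
  exists t. split; [exact Ht |]. intros x Ix.
  pose (D := fun x => p x * cos (t x) + q x * sin (t x)).
  assert (HD : forall y, I y -> is_derive D y 0).
  { intros y Iy.
    pose proof (Hp y Iy) as Dp. pose proof (Hq y Iy) as Dq.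
    pose proof (Ht y Iy) as Dt. unfold D.
    auto_derive.
    - repeat split; eexists; eassumption.
    - rewrite (is_derive_unique (fun z : R => p z) _ _ Dp),
        (is_derive_unique (fun z : R => q z) _ _ Dq),
        (is_derive_unique (fun z : R => t z) _ _ Dt). ring. }
  assert (HDx : D x = D a).
  { apply (antiderivative_eq (fun _ => 0) D (fun _ => D a)
             (Rmin a x) (Rmax a x) a x).
    - intros y Hy. apply HD. apply (proj2 HI (Rmin a x) (Rmax a x)); trivial.
      + unfold Rmin; now destruct Rle_dec.
      + unfold Rmax; now destruct Rle_dec.
    - intros y _. apply (is_derive_const (V := R_NormedModule)).
    - split; [apply Rmin_l | apply Rmax_l].
    - split; [apply Rmin_r | apply Rmax_r].
    - reflexivity. }
  assert (HDa : D a = 1).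
  { unfold D. rewrite Hta, <- Hpa, <- Hqa. now apply Hunit. }
  (* Two unit vectors with scalar product 1 coincide. *)
  pose proof (Hunit x Ix) as Hux. pose proof (sin2_cos2 (t x)) as Hsc.
  unfold Rsqr in Hsc. rewrite HDa in HDx. unfold D in HDx.
  split; apply Rminus_diag_uniq, Rsqr_0_uniq; unfold Rsqr; nra.
Qed.

End Rotation.

(** * The surface normal and the geodesic *)

(** A Galilean cross product has first component 0, so its Galilean norm is the Euclidean norm of
    the other two components, and dividing by it gives a Euclidean unit vector. *)
Lemma unit_normal_components (M : oriented_surface) (q : G3) :
  carrier M q ->
  c1 (unit_normal M q) = 0 /\
  c2 (unit_normal M q) * c2 (unit_normal M q)
    + c3 (unit_normal M q) * c3 (unit_normal M q) = 1.
Proof.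
  intros Hq.
  destruct (atlas M q Hq) as [U [X [HX [r [Ur <-]]]]].
  destruct (lp_regular _ _ _ _ HX) as [Xu [Xv H]].
  destruct (H r Ur) as [_ [_ [_ [_ [Hne ->]]]]].
  assert (H0 : c1 (gal_cross (Xu r) (Xv r)) = 0) by reflexivity.
  revert Hne H0. generalize (gal_cross (Xu r) (Xv r)). clear.
  intros v. rewrite (vec_eta v). generalize (c1 v) (c2 v) (c3 v). clear v.
  intros a b c Hne H0. change (a = 0) in H0. subst a.
  assert (Hpos : 0 < b * b + c * c).
  { destruct (Req_dec b 0) as [-> |]; [| nra].
    destruct (Req_dec c 0) as [-> |]; [| nra]. now destruct Hne. }
  assert (Hnorm : gal_norm (vec 0 b c) = sqrt (b * b + c * c)).
  { unfold gal_norm, gal_dot, c1, c2, c3; simpl.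
    destruct (Req_EM_T 0 0) as [_ | Hn]; [| lra].
    rewrite Rabs_pos_eq; [reflexivity | lra]. }
  rewrite Hnorm.
  pose proof (sqrt_lt_R0 _ Hpos) as Hs.
  pose proof (sqrt_sqrt _ (Rlt_le _ _ Hpos)) as Hss.
  set (s := sqrt (b * b + c * c)) in *.
  change (/ s * 0 = 0 /\ / s * b * (/ s * b) + / s * c * (/ s * c) = 1).
  split; [ring |].
  replace (/ s * b * (/ s * b) + / s * c * (/ s * c))
    with ((b * b + c * c) / (s * s)) by (field; lra).
  rewrite Hss. field. lra.
Qed.

Lemma is_derive_opp_R (f : R -> R) (x l : R) :
  is_derive f x l -> is_derive (fun t => - f t) x (- l).
Proof. exact (is_derive_opp (V := R_NormedModule) f x l). Qed.

Theorem theorem4p2 :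
  forall (M : oriented_surface) (I : R -> Prop) (beta T Q n : R -> G3)
    (kappa_g kappa_n tau_g : R -> R),
    is_open_interval I ->
    (forall x, I x -> carrier M (beta x)) ->
    unit_speed I beta ->
    darboux_frame M I beta T Q n ->
    darboux_equations I T Q n kappa_g kappa_n tau_g ->
    geodesic I kappa_g ->
    exists theta_S theta_C A_S A_C Y1 Y Z1 Z : R -> R,
      is_antiderivative I tau_g theta_S /\
      is_antiderivative I tau_g theta_C /\
      is_antiderivative I (fun x => tau_g x * sin (theta_S x)) A_S /\
      is_antiderivative I (fun x => tau_g x * cos (theta_C x)) A_C /\
      is_antiderivative I (fun x => kappa_n x * A_S x) Y1 /\
      is_antiderivative I Y1 Y /\
      is_antiderivative I (fun x => kappa_n x * A_C x) Z1 /\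
      is_antiderivative I Z1 Z /\
      forall x, I x -> beta x = vec x (- Y x) (- Z x).
Proof.
  intros M I beta T Q n kappa_g kappa_n tau_g HI Hcar Hspeed [HT Hn HQ]
    [HdT HdQ Hdn] Hgeo.
  (* As [I] is open, [c1] of [beta] is the identity near [x]; uniqueness of the derivative gives
     1. *)
  assert (HT1 : forall x, I x -> c1 (T x) = 1).
  { intros x Ix.
    rewrite <- (is_derive_unique _ _ _
      (is_derive_linear c1 beta x _ is_linear_c1 (HT x Ix))).
    apply is_derive_unique.
    apply is_derive_ext_loc with (fun t => t).
    - apply (filter_imp I); [| now apply HI].
      intros t It. symmetry. now apply Hspeed.
    - apply (is_derive_id (K := R_AbsRing)). }
  assert (Hn1 : forall x, I x -> c1 (n x) = 0).
  { intros x Ix. rewrite Hn by trivial. now apply unit_normal_components, Hcar. }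
  assert (Hunit : forall x, I x ->
            c2 (n x) * c2 (n x) + c3 (n x) * c3 (n x) = 1).
  { intros x Ix. rewrite Hn by trivial. now apply unit_normal_components, Hcar. }
  assert (HQ2 : forall x, I x -> c2 (Q x) = c3 (n x)).
  { intros x Ix. rewrite HQ by trivial.
    change (c3 (n x) * c1 (T x) - c1 (n x) * c3 (T x) = c3 (n x)).
    rewrite HT1, Hn1 by trivial. ring. }
  assert (HQ3 : forall x, I x -> c3 (Q x) = - c2 (n x)).
  { intros x Ix. rewrite HQ by trivial.
    change (c1 (n x) * c2 (T x) - c2 (n x) * c1 (T x) = - c2 (n x)).
    rewrite HT1, Hn1 by trivial. ring. }
  assert (Hn2' : forall x, I x ->
            is_derive (fun t => c2 (n t)) x (- tau_g x * c3 (n x))).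
  { intros x Ix. rewrite <- HQ2 by trivial.
    exact (is_derive_linear c2 n x _ is_linear_c2 (Hdn x Ix)). }
  assert (Hn3' : forall x, I x ->
            is_derive (fun t => c3 (n t)) x (tau_g x * c2 (n x))).
  { intros x Ix.
    replace (tau_g x * c2 (n x)) with (- tau_g x * c3 (Q x))
      by (rewrite HQ3 by trivial; ring).
    exact (is_derive_linear c3 n x _ is_linear_c3 (Hdn x Ix)). }
  assert (HT2' : forall x, I x ->
            is_derive (fun t => c2 (T t)) x (kappa_n x * c2 (n x))).
  { intros x Ix.
    replace (kappa_n x * c2 (n x))
      with (kappa_g x * c2 (Q x) + kappa_n x * c2 (n x))
      by (rewrite Hgeo by trivial; ring).
    exact (is_derive_linear c2 T x _ is_linear_c2 (HdT x Ix)). }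
  assert (HT3' : forall x, I x ->
            is_derive (fun t => c3 (T t)) x (kappa_n x * c3 (n x))).
  { intros x Ix.
    replace (kappa_n x * c3 (n x))
      with (kappa_g x * c3 (Q x) + kappa_n x * c3 (n x))
      by (rewrite Hgeo by trivial; ring).
    exact (is_derive_linear c3 T x _ is_linear_c3 (HdT x Ix)). }
  destruct (rotation_angle I (fun x => c2 (n x)) (fun x => c3 (n x)) tau_g
              HI Hunit Hn2' Hn3') as [t [Ht Hcs]].
  (* The derivative of [- c3 n] is [- tau_g cos t], which is [tau_g cos (t + PI)]; hence the shift
     by [PI] in the cosine only. *)
  exists t, (fun x => t x + PI), (fun x => - c2 (n x)), (fun x => - c3 (n x)),
    (fun x => - c2 (T x)), (fun x => - c2 (beta x)),
    (fun x => - c3 (T x)), (fun x => - c3 (beta x)).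
  refine (conj _ (conj _ (conj _ (conj _ (conj _ (conj _ (conj _ (conj _ _)))))))).
  - exact Ht.
  - now apply antiderivative_add_const.
  - intros x Ix. rewrite <- (proj2 (Hcs x Ix)).
    replace (tau_g x * c3 (n x)) with (- (- tau_g x * c3 (n x))) by ring.
    now apply is_derive_opp_R, Hn2'.
  - intros x Ix. rewrite neg_cos, <- (proj1 (Hcs x Ix)).
    replace (tau_g x * - c2 (n x)) with (- (tau_g x * c2 (n x))) by ring.
    now apply is_derive_opp_R, Hn3'.
  - intros x Ix. rewrite Ropp_mult_distr_r_reverse.
    now apply is_derive_opp_R, HT2'.
  - intros x Ix. apply is_derive_opp_R.
    exact (is_derive_linear c2 beta x _ is_linear_c2 (HT x Ix)).
  - intros x Ix. rewrite Ropp_mult_distr_r_reverse.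
    now apply is_derive_opp_R, HT3'.
  - intros x Ix. apply is_derive_opp_R.
    exact (is_derive_linear c3 beta x _ is_linear_c3 (HT x Ix)).
  - intros x Ix. rewrite !Ropp_involutive, (vec_eta (beta x)) at 1.
    now rewrite Hspeed.
Qed.
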